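(* There is a one-to-one correspondence between arbitrary real sequences $(c_{k,0})_{k\in\mathbb{N}}$ and formal differential parametrizations $$w(z,t)=\sum_{k=0}^{\infty}\alpha_{2k}(z)\,y^{(2k)}(t),\qquad u(t)=\sum_{k=0}^{\infty}\beta_{2k}\,y^{(2k)}(t)$$ of the Euler-Bernoulli beam, where the sequence corresponding to a parametrization consists of the coefficients $c_{k,0}$ of $z^2$ in the polynomials $\alpha_{2k}(z)$, $k\in\mathbb{N}$.
   Context: $\mathbb{N}$ includes $0$; $'$ denotes differentiation with respect to $z$; $y^{(m)}$ is the $m$-th time derivative of $y$. The Euler-Bernoulli beam is the system $\partial_t^2 w(z,t)=-\partial_z^4 w(z,t)$, $0\le z\le 1$, $t\ge 0$, with boundary conditions $w(0,t)=0$, $\partial_z w(0,t)=0$, $\partial_z^2 w(1,t)=u(t)$, $\partial_z^3 w(1,t)=0$, where $u(t)$ is the input. A formal differential parametrization (with time derivatives of even order only) consists of functions $\alpha_{2k}:[0,1]\to\mathbb{R}$ and real numbers $\beta_{2k}$, $k\in\mathbb{N}$, such that the series $w(z,t)=\sum_{k\ge 0}\alpha_{2k}(z)y^{(2k)}(t)$ and $u(t)=\sum_{k\ge 0}\beta_{2k}y^{(2k)}(t)$ formally (after interchanging differentiation and summation, without regard to convergence) satisfy the PDE and the boundary conditions for arbitrary smooth functions $y(t)$. This means that the factors of all time derivatives of $y$ vanish, i.e. $$\alpha_0''''(z)=0,\qquad \alpha_{2k}''''(z)=-\alpha_{2(k-1)}(z)\ \ (k\ge 1),$$ $$\alpha_{2k}(0)=0,\quad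 \alpha_{2k}'(0)=0,\quad \alpha_{2k}''(1)=\beta_{2k},\quad \alpha_{2k}'''(1)=0\ \ (k\ge 0).$$ The functions $\alpha_{2k}$ are then polynomials of the form $\alpha_{2k}(z)=\sum_{i=0}^{k}\left(c_{k,i}z^{4i+2}+d_{k,i}z^{4i+3}\right)$ with real coefficients $c_{k,i},d_{k,i}$ and $d_{k,k}=0$. Two parametrizations are regarded as equal if all their $\alpha_{2k}$ and $\beta_{2k}$ coincide. *)

(* Defs.v *)
From HB Require Import structures.
From mathcomp Require Import all_boot all_order all_algebra.
From mathcomp Require Import all_classical all_reals all_analysis.
Set Implicit Arguments.
Unset Strict Implicit.
Unset Printing Implicit Defensive.
Import Order.TTheory GRing.Theory Num.Theory.
Import numFieldNormedType.Exports.
Local Open Scope classical_set_scope.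
Local Open Scope ring_scope.

(* The interval [0, 1] as a type; `set_type` carries the subset topology, so
   that functions on [0, 1] are compared by Leibniz equality. *)
Definition unit_itv (R : realType) : set R := `[0, 1].
Notation I01 R := (set_type (@unit_itv R)).

Lemma unit_itv0 (R : realType) : (0 : R) \in @unit_itv R.
Proof. by rewrite inE /unit_itv /= in_itv /= lexx ler01. Qed.

Lemma unit_itv1 (R : realType) : (1 : R) \in @unit_itv R.
Proof. by rewrite inE /unit_itv /= in_itv /= lexx ler01. Qed.

Definition z0 {R : realType} : I01 R := exist _ 0 (unit_itv0 R).
Definition z1 {R : realType} : I01 R := exist _ 1 (unit_itv1 R).

Definition diff_quotient (R : realType) (f : I01 R -> R) (z x : I01 R) : R :=
  (f x - f z) / (\val x - \val z).

(* Here z^' is the punctured neighborhood filter in [0, 1]: the derivative is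
   one-sided at 0 and at 1. *)
Definition differentiable01 (R : realType) (f : I01 R -> R) : Prop :=
  forall z : I01 R, cvg (diff_quotient f z x @[x --> z^']).

(* Only meaningful for f differentiable ([lim] is total). *)
Definition deriv01 (R : realType) (f : I01 R -> R) : I01 R -> R :=
  fun z => lim (diff_quotient f z x @[x --> z^']).

Definition derivn01 (R : realType) (n : nat) (f : I01 R -> R) : I01 R -> R :=
  iter n (@deriv01 R) f.

Definition differentiablen01 (R : realType) (n : nat) (f : I01 R -> R) : Prop :=
  forall m : nat, (m < n)%N -> differentiable01 (derivn01 m f).

(* Formal differential parametrizations
     w(z,t) = \sum_k alpha_{2k}(z) y^(2k)(t),  u(t) = \sum_k beta_{2k} y^(2k)(t)
   of the Euler-Bernoulli beam  d_t^2 w = - d_z^4 w,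
     w(0,t) = 0, d_z w(0,t) = 0, d_z^2 w(1,t) = u(t), d_z^3 w(1,t) = 0.
   [alpha k] and [beta k] stand for alpha_{2k} and beta_{2k}; the conditions
   equate to zero the factor of each time derivative of y. *)
Record parametrization (R : realType) := Parametrization {
  alpha : nat -> I01 R -> R ;
  beta : nat -> R ;
  alpha_diff : forall k, differentiablen01 4 (alpha k) ;
  alpha_pde0 : forall z, derivn01 4 (alpha 0%N) z = 0 ;
  alpha_pdeS : forall k z, derivn01 4 (alpha k.+1) z = - alpha k z ;
  alpha_bc0 : forall k, alpha k z0 = 0 ;
  alpha_bc1 : forall k, derivn01 1 (alpha k) z0 = 0 ;
  alpha_bc2 : forall k, derivn01 2 (alpha k) z1 = beta k ;
  alpha_bc3 : forall k, derivn01 3 (alpha k) z1 = 0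
}.

Lemma parametrization_eqP (R : realType) (P Q : parametrization R) :
  P = Q <-> (forall k z, alpha P k z = alpha Q k z) /\
            (forall k, beta P k = beta Q k).
Proof.
split=> [-> //|[]].
case: P => a b p1 p2 p3 p4 p5 p6 p7; case: Q => a' b' q1 q2 q3 q4 q5 q6 q7 /=.
move=> ea eb.
have eqa : a = a' by apply/funext => k; apply/funext => z; exact: ea.
have eqb : b = b' by apply/funext => k; exact: eb.
by subst; congr Parametrization; exact: Prop_irrelevance.
Qed.

(* [c 0] is the coefficient of z^2. *)
Definition beam_polynomial (R : realType) (k : nat) (c d : nat -> R) : {poly R} :=
  \sum_(i < k.+1) (c i *: 'X^(4 * i + 2) + d i *: 'X^(4 * i + 3)).

(* Main.v *)
Require Import Defs.
From HB Require Import structures.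
From mathcomp Require Import all_boot all_order all_algebra.
From mathcomp Require Import all_classical all_reals all_analysis.
From mathcomp Require Import ring lra.
Import Order.TTheory GRing.Theory Num.Theory.
Import numFieldNormedType.Exports.
Local Open Scope classical_set_scope.
Local Open Scope ring_scope.

(* The boundary conditions p(0) = p'(0) = p'''(1) = 0 determine a solution of
   p'''' = q on [0, 1] up to the value of p''(0): integrate q from 0, subtract
   the constant making the result vanish at 1, add p''(0) to the next
   primitive, and integrate twice more. So the alpha_{2k} are obtained
   recursively, with p''(0) = 2 c_{k,0} free at each step, and beta_{2k} is read
   off from alpha_{2k}. Uniqueness is the fact, from the mean value theorem,
   that a function on [0, 1] with zero derivative is constant. *)

(** * The punctured neighborhood filter on [0, 1] *)

Lemma I01P {R : realType} (z : I01 R) : 0 <= \val z <= 1.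
Proof. by have := valP z; rewrite inE /unit_itv /= in_itv. Qed.

Lemma dnbhs01P {R : realType} (z : I01 R) (P : set (I01 R)) :
  z^' P <-> exists2 d : R, 0 < d &
    forall x, x != z -> `|\val z - \val x| < d -> P x.
Proof.
split.
  move=> /nbhs_ballP[d /= d0 dP]; exists d => // x xz zx.
  by apply: dP => //; rewrite -initial_ballE.
move=> [d d0 dP]; apply/nbhs_ballP; exists d => //= x; rewrite -initial_ballE.
by move=> zx xz; exact: dP.
Qed.

Lemma cvg_dnbhs01P {R : realType} (f : I01 R -> R) (z : I01 R) (l : R) :
  f x @[x --> z^'] --> l <-> forall e, 0 < e -> exists2 d : R, 0 < d &
    forall x, x != z -> `|\val z - \val x| < d -> `|l - f x| < e.
Proof.
split => [/cvgrPdist_lt fl e /fl /dnbhs01P//|fl].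
by apply/cvgrPdist_lt => e /fl /dnbhs01P.
Qed.

(** Limits are unique because no point of [0, 1] is isolated: a small move by [h], at most 1/2,
    towards the farther endpoint stays inside. *)
#[local] Instance dnbhs01_filter {R : realType} (z : I01 R) :
  ProperFilter z^'.
Proof.
apply: Build_ProperFilter_ex => P /dnbhs01P[d d0 dP].
have /andP[z_ge0 z_le1] := I01P z.
pose h := Num.min d 1 / 2.
have h0 : 0 < h by rewrite divr_gt0// lt_min d0 /=.
have m_d : Num.min d 1 <= d by rewrite ge_min lexx.
have m_1 : Num.min d 1 <= 1 by rewrite ge_min lexx orbT.
have hd : h < d by rewrite /h in h0 *; lra.
have h1 : h <= 1 / 2 by rewrite /h; lra.
pose y := if \val z <= 1 / 2 then \val z + h else \val z - h.
have yI : y \in @unit_itv R.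
  by rewrite inE /unit_itv /= in_itv /= /y; case: ifPn; rewrite -?ltNge; lra.
have zy : `|\val z - y| = h.
  rewrite /y; case: ifPn => _; last by rewrite subKr gtr0_norm.
  by rewrite opprD addNKr normrN gtr0_norm.
exists (exist _ y yI : I01 R); apply: dP; last by rewrite zy.
by apply: contraTneq h0 => /(congr1 val)/= yz; rewrite -zy yz subrr normr0 ltxx.
Qed.

(** * Polynomials as functions on [0, 1] *)

Definition polyfun01 {R : realType} (p : {poly R}) (z : I01 R) : R :=
  p.[\val z].

Lemma continuous_polyfun01 {R : realType} (p : {poly R}) :
  continuous (polyfun01 p).
Proof.
move=> z; apply: (@continuous_comp _ _ _ (set_val : I01 R -> R) (horner p)).
  exact: initial_continuous.
exact: continuous_horner.
Qed.

(** Factor $p - p(z) = q (X - z)$: off [z] the quotient equals [q], and differentiating the product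
    gives $p'(z) = q(z)$. *)
Lemma cvg_diff_quotient_poly {R : realType} (p : {poly R}) (z : I01 R) :
  diff_quotient (polyfun01 p) z x @[x --> z^'] --> polyfun01 p^`() z.
Proof.
have : root (p - p.[\val z]%:P) (\val z) by rewrite rootE !hornerE subrr.
move=> /factor_theorem[q] /(canRL (subrK _)) ->.
set c := p.[_]; rewrite derivD derivM derivXsubC derivC.
rewrite [polyfun01 (_ + 0) z]/polyfun01 !hornerE subrr mulr0 add0r.
have qz : polyfun01 q x @[x --> z^'] --> q.[\val z].
  by apply: cvg_within_filter; exact: continuous_polyfun01.
apply: cvg_trans qz.
apply: near_eq_cvg; apply/dnbhs01P; exists 1 => // x xz _.
rewrite /diff_quotient /polyfun01 !hornerE subrr mulr0 add0r addrK.
by rewrite mulfK// subr_eq0.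
Qed.

Lemma differentiable01_poly {R : realType} (p : {poly R}) :
  differentiable01 (polyfun01 p).
Proof. by move=> z; apply/cvg_ex; eexists; exact: cvg_diff_quotient_poly. Qed.

Lemma deriv01_poly {R : realType} (p : {poly R}) :
  deriv01 (polyfun01 p) = polyfun01 p^`().
Proof.
apply/funext => z.
by apply: cvg_lim; [exact: Rhausdorff|exact: cvg_diff_quotient_poly].
Qed.

Lemma derivn01_poly {R : realType} (n : nat) (p : {poly R}) :
  derivn01 n (polyfun01 p) = polyfun01 p^`(n).
Proof.
by elim: n => // n IHn; rewrite /derivn01 iterS -/(derivn01 n _) IHn
  deriv01_poly derivnS.
Qed.

Lemma differentiablen01_poly {R : realType} (n : nat) (p : {poly R}) :
  differentiablen01 n (polyfun01 p).
Proof. by move=> m _; rewrite derivn01_poly; exact: differentiable01_poly. Qed.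

(** * Functions on [0, 1] with prescribed derivative *)

Lemma differentiable01_continuous {R : realType} (f : I01 R -> R) :
  differentiable01 f -> continuous f.
Proof.
move=> df z.
suff fz : f x @[x --> z^'] --> f z.
  apply/(@cvgrPdist_lt _ _ _ (nbhs z) (nbhs_filter z)) => e e0.
  move/cvg_dnbhs01P : fz => /(_ e e0)[d d0 dP].
  apply/nbhs_ballP; exists d => //= x; rewrite -initial_ballE => zx.
  have [->|xz] := eqVneq x z; first by rewrite subrr normr0.
  exact: dP.
(* The right-hand side is the limit of $f(z) + Q(x)(x - z)$, with $Q$ the difference quotient; off
   [z] this expression is $f(x)$. *)
have -> : f z = f z + deriv01 f z * (\val z - \val z).
  by rewrite subrr mulr0 addr0.
have vz : \val x - \val z @[x --> z^'] --> \val z - \val z.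
  apply: cvgB; last exact: cvg_cst.
  apply: cvg_within_filter.
  exact: (@initial_continuous _ _ (set_val : I01 R -> R) z).
apply: cvg_trans (cvgD (cvg_cst (f z)) (cvgM (df z) vz)).
apply: near_eq_cvg; apply/dnbhs01P; exists 1 => // x xz _.
by rewrite /diff_quotient fctE /= mulfVK ?subr_eq0// addrC subrK.
Qed.

(** The mean value theorem on $[0, z]$ is applied to [valL f], an extension of [f] to the real line:
    it has two-sided derivative 0 inside $]0, 1[$ and is continuous within [0, 1]. *)
Lemma deriv01_eq0_cst {R : realType} (f : I01 R -> R) :
  differentiable01 f -> (forall z, deriv01 f z = 0) -> forall z, f z = f z0.
Proof.
move=> df f0 z.
have /subspace_valL_continuousP cf := differentiable01_continuous f df.
have valLE (x : I01 R) : valL f (\val x) = f x.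
  exact: (congr1 (@^~ x) (@valLK _ _ point _ f)).
have Df (x : R) : x \in `]0, 1[ -> is_derive x 1 (valL f) 0.
  rewrite in_itv /= => /andP[x0 x1].
  have xI : x \in @unit_itv R by rewrite inE /unit_itv /= in_itv /= !ltW.
  pose w : I01 R := exist _ x xI.
  suff H : h^-1 *: ((valL f \o shift x) (h *: 1) - valL f x) @[h --> 0^']
      --> (0 : R).
    by apply: DeriveDef; [apply/cvg_ex; exists 0|exact: cvg_lim].
  have fw : diff_quotient f w y @[y --> w^'] --> deriv01 f w by exact: df.
  move: fw; rewrite f0 => /cvg_dnbhs01P fw.
  apply/cvgrPdist_lt => e /fw[d d0 dP].
  (* Increments below [m] keep $x + h$ in [0, 1], so the real quotient of [valL f] is a difference
     quotient of [f]. *)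
  pose m := Num.min d (Num.min x (1 - x)).
  have m0 : 0 < m by rewrite !lt_min d0 x0 subr_gt0.
  apply/nbhs_ballP; exists m => //= h.
  rewrite /ball/= sub0r normrN !lt_min => /and3P[hd hx h1] hneq0.
  have yI : h + x \in @unit_itv R.
    rewrite inE /unit_itv /= in_itv /=.
    by move: hx h1; rewrite !ltr_norml; lra.
  pose y : I01 R := exist _ (h + x) yI.
  have yw : y != w.
    apply: contra_neq hneq0 => /(congr1 val)/= /(canRL (addrK _)).
    by rewrite subrr.
  have := dP y yw; rewrite /diff_quotient /= -!valLE /=.
  rewrite opprD addrCA subrr addr0 normrN addrK.
  by move=> /(_ hd); rewrite /shift/= /GRing.scale/= mulr1 [h^-1 * _]mulrC.
have /andP[] := I01P z; rewrite le_eqVlt => /predU1P[z_eq0 _|z_gt0 z_le1].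
  by congr f; apply: val_inj.
rewrite -[f z]valLE -[f z0]valLE /=; apply/eqP; rewrite -subr_eq0; apply/eqP.
have [||c _ ->] := @MVT R (valL f) (fun=> 0) 0 (\val z) z_gt0;
  [| |by rewrite mul0r].
  move=> x; rewrite in_itv/= => /andP[x0 xz]; apply: Df; rewrite in_itv /= x0.
  exact: lt_le_trans z_le1.
apply: continuous_subspaceW cf => x /=.
rewrite /unit_itv /= !in_itv /= => /andP[-> xz].
exact: le_trans z_le1.
Qed.

(** The difference of [f] and the polynomial has zero derivative and vanishes at [z0]. This serves
    to integrate one order at a time. *)
Lemma deriv01_eq_poly {R : realType} (f : I01 R -> R) (p : {poly R}) :
  differentiable01 f -> deriv01 f = polyfun01 p^`() ->
  f z0 = p.[0] -> f = polyfun01 p.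
Proof.
move=> df fp fp0; apply/funext => z.
have cg w : diff_quotient (f \- polyfun01 p) w x @[x --> w^'] --> (0 : R).
  rewrite -(subrr (deriv01 f w)) {2}fp.
  apply: cvg_trans (cvgB (df w) (cvg_diff_quotient_poly p w)).
  apply: near_eq_cvg; apply/dnbhs01P; exists 1 => // x xz _.
  by rewrite /diff_quotient /= !fctE /=; ring.
have dg : differentiable01 (f \- polyfun01 p).
  by move=> w; apply/cvg_ex; exists 0; exact: cg.
have g0 w : deriv01 (f \- polyfun01 p) w = 0 by apply: cvg_lim => //; exact: cg.
apply/eqP; rewrite -subr_eq0; apply/eqP.
by rewrite [LHS](deriv01_eq0_cst _ dg g0 z) /= fp0 subrr.
Qed.

(** * Formal primitives vanishing at 0, and the boundary value problem of one step *)

Definition integ {R : numFieldType} (p : {poly R}) : {poly R} :=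
  \poly_(i < (size p).+1) (p`_i.-1 / i%:R).

(* At i = 0 both sides vanish since x / 0 = 0. *)
Lemma coef_integ {R : numFieldType} (p : {poly R}) (i : nat) :
  (integ p)`_i = p`_i.-1 / i%:R.
Proof.
rewrite coef_poly ltnS; case: leqP => //; case: i => // i.
by rewrite ltnS => pi; rewrite nth_default// mul0r.
Qed.

Lemma integ_is_linear {R : numFieldType} : linear (@integ R).
Proof.
by move=> a p q; apply/polyP => i; rewrite !(coefD, coefZ, coef_integ); ring.
Qed.

HB.instance Definition _ (R : numFieldType) :=
  GRing.isLinear.Build R {poly R} {poly R} _ (@integ R) integ_is_linear.

Lemma integK {R : numFieldType} : cancel (@integ R) (@deriv R).
Proof.
move=> p; apply/polyP => i.
by rewrite coef_deriv coef_integ /= -[LHS]mulr_natr divfK// pnatr_eq0.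
Qed.

Lemma integ_horner0 {R : numFieldType} (p : {poly R}) : (integ p).[0] = 0.
Proof. by rewrite horner_coef0 coef_integ invr0 mulr0. Qed.

Lemma integXn {R : numFieldType} (n : nat) :
  integ 'X^n = n.+1%:R^-1 *: 'X^(n.+1) :> {poly R}.
Proof.
apply/polyP => -[|i]; rewrite coef_integ coefZ !coefXn /=.
  by rewrite invr0 !mulr0.
rewrite eqSS; case: eqVneq => [->|_]; first by rewrite mulrC.
by rewrite mul0r mulr0.
Qed.

(* The solution of p'''' = q, p(0) = p'(0) = 0, p'''(1) = 0 in which z^2 has
   coefficient c. *)
Definition beam_solution {R : numFieldType} (c : R) (q : {poly R}) : {poly R} :=
  integ (integ (integ (integ q - (integ q).[1]%:P) + (2 * c)%:P)).

Lemma deriv1_beam_solution {R : numFieldType} (c : R) (q : {poly R}) :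
  (beam_solution c q)^`(1) =
  integ (integ (integ q - (integ q).[1]%:P) + (2 * c)%:P).
Proof. by rewrite derivn1 integK. Qed.

Lemma deriv2_beam_solution {R : numFieldType} (c : R) (q : {poly R}) :
  (beam_solution c q)^`(2) = integ (integ q - (integ q).[1]%:P) + (2 * c)%:P.
Proof. by rewrite derivnS deriv1_beam_solution integK. Qed.

Lemma deriv3_beam_solution {R : numFieldType} (c : R) (q : {poly R}) :
  (beam_solution c q)^`(3) = integ q - (integ q).[1]%:P.
Proof. by rewrite derivnS deriv2_beam_solution derivD derivC addr0 integK. Qed.

Lemma deriv4_beam_solution {R : numFieldType} (c : R) (q : {poly R}) :
  (beam_solution c q)^`(4) = q.
Proof.
by rewrite derivnS deriv3_beam_solution derivB derivC subr0 integK.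
Qed.

(** Integrating the constant $2c$ twice gives $c X^2$; integrating the constant $-(\int_0^1 q)$
    three times gives the cubic term. *)
Lemma beam_solutionE {R : numFieldType} (c : R) (q : {poly R}) :
  beam_solution c q =
  iter 4 integ q + (c *: 'X^2 + - (integ q).[1] / 6 *: 'X^3).
Proof.
have integC a : integ a%:P = a *: 'X :> {poly R}.
  by rewrite -alg_polyC linearZ /= (integXn 0) invr1 scale1r.
have integX : integ 'X = 2^-1 *: 'X^2 :> {poly R} by exact: (integXn 1).
rewrite /beam_solution; set t := (integ q).[1].
rewrite !(linearD, linearN) /= !integC.
do 2 rewrite !linearZ /= ?integX ?integXn.
rewrite !(scaleNr, scalerN, scalerA) -!scaleNr -addrA.
congr (_ + _); rewrite addrC; congr (_ + _); last first.
  by congr (_ *: _); rewrite /GRing.scale /=; field.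
by congr (_ *: _); field.
Qed.

(** The derivatives of orders 3, 2, 1, 0 are recovered in turn from their values at 0. For order 3
    that value is forced by the condition at 1; for order 2 it stays free. *)
Lemma beam_solution_unique {R : realType} (f : I01 R -> R) (q : {poly R}) :
  differentiablen01 4 f -> derivn01 4 f = polyfun01 q ->
  f z0 = 0 -> derivn01 1 f z0 = 0 -> derivn01 3 f z1 = 0 ->
  f = polyfun01 (beam_solution (derivn01 2 f z0 / 2) q).
Proof.
move=> df f4 f0 f1 f3.
have {f4} D3 : derivn01 3 f = polyfun01 (integ q + (derivn01 3 f z0)%:P).
  apply: deriv01_eq_poly; first exact: df.
    by rewrite derivD derivC addr0 integK.
  by rewrite !hornerE integ_horner0 add0r.
have f30 : derivn01 3 f z0 = - (integ q).[1].
  move: f3; rewrite D3 /polyfun01 /= !hornerE integ_horner0 add0r => /eqP.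
  by rewrite addrC addr_eq0 => /eqP.
rewrite {}f30 polyCN in D3.
have D2 : derivn01 2 f =
    polyfun01 (beam_solution (derivn01 2 f z0 / 2) q)^`(2).
  apply: deriv01_eq_poly; first exact: (df 2%N).
    by rewrite -derivnS deriv3_beam_solution.
  rewrite deriv2_beam_solution hornerD hornerC integ_horner0 add0r.
  by rewrite mulrC divfK.
have D1 : derivn01 1 f =
    polyfun01 (beam_solution (derivn01 2 f z0 / 2) q)^`(1).
  apply: deriv01_eq_poly; first exact: (df 1%N).
    by rewrite -derivnS.
  by rewrite deriv1_beam_solution integ_horner0.
apply: deriv01_eq_poly; [exact: (df 0%N)|by rewrite -derivn1|].
by rewrite integ_horner0.
Qed.

(** * The recursion and the bijection *)

Fixpoint beam_poly {R : realType} (c : nat -> R) (k : nat) : {poly R} :=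
  beam_solution (c k) (if k is j.+1 then - beam_poly c j else 0).

(** Fourfold integration raises exponents by 4, so index [i] moves to [i + 1], and each step adds
    fresh terms at index 0. As the first polynomial has no cubic term, the top coefficient [d k]
    stays 0. *)
Lemma beam_poly_form {R : realType} (c : nat -> R) (k : nat) :
  exists c' d : nat -> R,
    [/\ d k = 0, beam_poly c k = beam_polynomial k c' d & c' 0%N = c k].
Proof.
elim: k => [|k [c' [d [dk E _]]]] /=.
  exists c, (fun=> 0); split => //.
  rewrite beam_solutionE /= !linear0 horner0 add0r oppr0 mul0r scale0r.
  by rewrite /beam_polynomial big_ord1 scale0r.
(* This is $n!/(n+4)!$, the factor produced by four integrations of $X^n$. *)
pose w n : R := n.+1%:R^-1 * n.+2%:R^-1 * n.+3%:R^-1 * n.+4%:R^-1.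
have integ4Xn n : iter 4 integ 'X^n = w n *: 'X^(n.+4) :> {poly R}.
  rewrite /=; do 4 rewrite ?linearZ /= ?integXn.
  by rewrite !scalerA /w; congr (_ *: _); ring.
set e := - (integ (- beam_poly c k)).[1] / 6.
exists (fun i => if i is j.+1 then - c' j * w (4 * j + 2)%N else c k.+1).
exists (fun i => if i is j.+1 then - d j * w (4 * j + 3)%N else e).
split => //; first by rewrite dk oppr0 mul0r.
rewrite beam_solutionE -/e [RHS]/beam_polynomial big_ord_recl addrC.
(* Bundled as a linear map, the four integrations pass through the sum at once. *)
pose integ4 : {linear {poly R} -> {poly R}} :=
  integ \o integ \o integ \o integ.
rewrite -[iter 4 integ _]/(integ4 _) E; congr (_ + _).
rewrite linearN linear_sum -sumrN; apply: eq_bigr => i _.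
rewrite linearD !linearZ /= -![integ (integ _)]/(iter 4 integ _) !integ4Xn.
rewrite /bump /= add1n mulnS !scalerA !mulNr !scaleNr opprD.
by rewrite !add4n.
Qed.

Definition beam_parametrization {R : realType} (c : nat -> R) :
  parametrization R.
Proof.
pose a k := polyfun01 (beam_poly c k).
(* With [beta] chosen as the second derivative at 1, that boundary condition holds by definition. *)
apply: (@Parametrization R a (fun k => derivn01 2 (a k) z1)) => //.
- by move=> k; exact: differentiablen01_poly.
- by move=> z; rewrite /a derivn01_poly deriv4_beam_solution /polyfun01 horner0.
- by move=> k z; rewrite /a derivn01_poly deriv4_beam_solution /polyfun01
    hornerN.
- by move=> [|k]; rewrite /a /polyfun01 integ_horner0.
- by move=> [|k]; rewrite /a derivn01_poly deriv1_beam_solution /polyfun01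
    integ_horner0.
- by move=> [|k]; rewrite /a derivn01_poly deriv3_beam_solution /polyfun01
    !hornerE subrr.
(* Transparent, since the proof of bijectivity computes [alpha] of this record. *)
Defined.

(** Polynomiality propagates by induction: the source at step [k + 1] is minus the polynomial found
    at step [k], so [beam_solution_unique] applies. *)
Lemma alpha_eq_beam_poly {R : realType} (P : parametrization R) (k : nat) :
  alpha P k = polyfun01 (beam_poly (fun k => derivn01 2 (alpha P k) z0 / 2) k).
Proof.
elim: k => [|k IHk]; apply: beam_solution_unique.
- exact: alpha_diff.
- by apply/funext => z; rewrite alpha_pde0 /polyfun01 horner0.
- exact: alpha_bc0.
- exact: alpha_bc1.
- exact: alpha_bc3.
- exact: alpha_diff.
- by apply/funext => z; rewrite alpha_pdeS IHk /polyfun01 hornerN.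
- exact: alpha_bc0.
- exact: alpha_bc1.
- exact: alpha_bc3.
Qed.

Theorem corollary4 (R : realType) :
  exists F : parametrization R -> (nat -> R),
    (forall (P : parametrization R) (k : nat),
      exists c d : nat -> R,
        [/\ d k = 0,
            forall z : I01 R, alpha P k z = (beam_polynomial k c d).[\val z]
          & F P k = c 0%N]) /\
    bijective F.
Proof.
(* Half the second derivative at 0 is the coefficient of $z^2$. *)
exists (fun P k => derivn01 2 (alpha P k) z0 / 2); split.
  move=> P k.
  have [c [d [dk E c0]]] :=
    beam_poly_form (fun k => derivn01 2 (alpha P k) z0 / 2) k.
  exists c, d; split => // z.
  by rewrite alpha_eq_beam_poly /polyfun01 E.
exists beam_parametrization => [P|c].
  have aE k : alpha (beam_parametrization
      (fun k => derivn01 2 (alpha P k) z0 / 2)) k = alpha P k.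
    by rewrite [RHS]alpha_eq_beam_poly.
  apply/parametrization_eqP; split=> [k z|k]; first by rewrite aE.
  (* [beta] is determined by [alpha] through the condition at 1. *)
  by rewrite -!alpha_bc2 aE.
apply/funext => -[|k]; rewrite derivn01_poly deriv2_beam_solution /polyfun01;
  by rewrite !hornerE integ_horner0 add0r mulrAC divff ?mul1r.
Qed.
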